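(* For $L=4$, all coefficients of the formal power series $G_{L,2}(q)+q^3+q^9$ are nonnegative.
   Context: A partition $\pi$ is a weakly decreasing finite list of positive integers (its parts); $|\pi|$ denotes the sum of its parts. Let $\mho$ be the set of partitions $\pi$ with $|\pi|>0$, and for $\pi \in \mho$ let $s(\pi)$ and $l(\pi)$ denote the smallest and largest parts of $\pi$, respectively. For a positive integer $L$, define $$G_{L,2}(q) = \sum_{\substack{\pi \in \mho,\\ s(\pi)=2,\\ l(\pi)-s(\pi)\leq L}} q^{|\pi|} - \sum_{\substack{\pi \in \mho,\\ s(\pi)\geq 3,\\ l(\pi)-s(\pi)\leq L}} q^{|\pi|}.$$ *)

(* Defs.v *)
From mathcomp Require Import all_boot all_order all_algebra.

Set Implicit Arguments.
Unset Strict Implicit.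
Unset Printing Implicit Defensive.

Import GRing.Theory.
Local Open Scope ring_scope.

Definition is_partition (p : seq nat) : bool := sorted geq p && all (leq 1) p.

(* As the parts are listed in weakly decreasing order, the smallest part is the
   last one and the largest part is the first one (both default to 0 on the
   empty partition). *)
Definition smallest_part (p : seq nat) : nat := last 0%N p.
Definition largest_part (p : seq nat) : nat := head 0%N p.

Definition mho (p : seq nat) : bool := is_partition p && (0 < sumn p)%N.

(* A formal power series in q is represented by its sequence of coefficients;
   sums and differences of series are the pointwise \+ and \-. *)
Definition fps := nat -> int.

Definition qX (k : nat) : fps := fun n => (n == k)%:Z.

(* The series \sum q^|p| over the p in mho satisfying P. A partition of n has at
   most n parts, all of which are at most n, so counting among the sequences of
   length at most n over 'I_n.+1 misses none: see coef_mho_series. *)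
Definition mho_series (P : pred (seq nat)) : fps := fun n =>
  #|[set b : n.-bseq 'I_n.+1 | let p := [seq val i | i <- b] in
       [&& mho p, sumn p == n & P p]]|%:Z.

Definition G2 (L : nat) : fps :=
  mho_series (fun p => (smallest_part p == 2%N) &&
                       (largest_part p - smallest_part p <= L)%N)
  \- mho_series (fun p => (3 <= smallest_part p)%N &&
                          (largest_part p - smallest_part p <= L)%N).

Lemma partition_size p : is_partition p -> (size p <= sumn p)%N.
Proof.
case/andP=> _; elim: p => //= x p IH /andP[x0 /IH].
by rewrite -add1n; apply: leq_add.
Qed.

Lemma part_le_sumn p x : x \in p -> (x <= sumn p)%N.
Proof.
elim: p => //= y p IH; rewrite inE => /orP[/eqP ->|/IH]; first exact: leq_addr.
by move/leq_trans; apply; apply: leq_addl.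
Qed.

Lemma coef_mho_series (P : pred (seq nat)) (n : nat) (e : seq (seq nat)) :
    uniq e -> (forall p, (p \in e) = [&& mho p, sumn p == n & P p]) ->
  mho_series P n = (size e)%:Z.
Proof.
move=> ue eE; congr Posz.
pose f (b : n.-bseq 'I_n.+1) := [seq val i | i <- b].
have f_inj : injective f.
  by move=> a b /(inj_map val_inj) /val_inj.
rewrite cardE -(size_map f); apply: perm_size; apply: uniq_perm => //.
  by rewrite (map_inj_uniq f_inj) enum_uniq.
move=> p; apply/mapP/idP => [[b]|].
  by rewrite mem_enum inE => bP ->; rewrite eE.
rewrite eE => pP; have /and3P[/andP[pp _] /eqP sp _] := pP.
have sz : (size [seq inord x : 'I_n.+1 | x <- p] <= n)%N.
  by rewrite size_map; apply: leq_trans (partition_size pp) _; rewrite sp.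
have fb : f (Bseq sz) = p.
  rewrite /f /= -map_comp -[RHS]map_id; apply/eq_in_map => x xp /=.
  by rewrite inordK // ltnS; apply: leq_trans (part_le_sumn xp) _; rewrite sp.
by exists (Bseq sz); rewrite ?fb // mem_enum inE -/(f _) fb.
Qed.

(* Main.v *)
Require Import Defs.
From mathcomp Require Import all_boot all_order all_algebra.
From mathcomp Require Import zify ring.

Set Implicit Arguments.
Unset Strict Implicit.
Unset Printing Implicit Defensive.

Import Order.TTheory GRing.Theory Num.Theory.
Local Open Scope ring_scope.

(** Write 1/(a, b, ...) for 1/((1-q^a)(1-q^b)...), the series counting the
    partitions whose parts belong to {a, b, ...}.

    Removing one part 2 shows that the first sum in G_{4,2} is q^2/(2,3,4,5,6).
    The second sum B, over the partitions with smallest part at least 3 and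
    spread at most 4, telescopes. Partitions with smallest part m contribute
    q^m/(m,...,m+4), and
      (1-q^4) q^m/(m,...,m+4) = 1/(m,...,m+3) - 1/(m+1,...,m+4),
    so that (1-q^4) B = 1/(3,4,5,6) - 1 ([spread_telescope]). Since moreover
    (1-q^4) q^2/(2,3,4,5,6) = (q^2+q^4)/(3,4,5,6), the sum G = G_{4,2} satisfies
      (1-q^4) G = 1 + (q^2+q^4-1)/(3,4,5,6)          ([G2_geom]).

    The numerator q^2+q^4-1 has a single negative coefficient, at q^0. Dividing
    a series by 1-q^k replaces its coefficients by the partial sums along each
    residue class modulo k; hence, if the coefficients are nonnegative from some
    point on, the quotient is nonnegative from M on as soon as it is so on one
    period M, ..., M+k-1 ([geom_eventually_ge0]). Dividing by 1-q^4, 1-q^3,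
    1-q^5, 1-q^6 and 1-q^4 in this order, every such period lies below 16, and
    this yields nonnegativity of the coefficients of G from q^10 on. The first
    ten coefficients are computed: the only negative ones are -1 at q^3 and
    at q^9. *)

(** * Shifting and geometric series *)

Definition shift (k : nat) (a : fps) : fps :=
  fun n => if (k <= n)%N then a (n - k)%N else 0.

(** The quotient of the series [a] by 1 - q^k, as an explicit sum over a list so
    that its coefficients can be evaluated by conversion. *)
Definition geom (k : nat) (a : fps) : fps :=
  fun n => foldr +%R 0 [seq a (n - j * k)%N | j <- iota 0 (n %/ k).+1].

Lemma eq_shift k a b : a =1 b -> shift k a =1 shift k b.
Proof. by move=> eab n; rewrite /shift eab. Qed.

Lemma shiftD k a b : shift k (a \+ b) =1 shift k a \+ shift k b.
Proof. by move=> n; rewrite /shift /=; case: ifP => // _; rewrite addr0. Qed.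

Lemma shiftB k a b : shift k (a \- b) =1 shift k a \- shift k b.
Proof. by move=> n; rewrite /shift /=; case: ifP => // _; rewrite subr0. Qed.

Lemma shift_shift j k a : shift j (shift k a) =1 shift (j + k) a.
Proof.
move=> n; rewrite /shift; case: leqP => [jn|nj].
  by rewrite leq_subRL // subnDA.
by rewrite leqNgt ltn_addr.
Qed.

Lemma geomE k a n : (0 < k)%N -> geom k a n = a n + shift k (geom k a) n.
Proof.
move=> k0; rewrite /geom /shift; case: leqP => [kn|nk]; last first.
  by rewrite divn_small //= mul0n subn0.
have -> : (n %/ k)%N = ((n - k) %/ k).+1.
  by rewrite -{1}(subnKC kn) -{1}[k]mul1n divnMDl.
have iotaS m : iota 0 m.+1 = 0%N :: map succn (iota 0 m).
  by rewrite /= -[1%N]addn0 iotaDl.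
rewrite iotaS; move: (iota _ _) => s; rewrite /= mul0n subn0 -map_comp.
congr (_ + foldr _ _ _); apply: eq_map => j /=.
by rewrite mulSn subnDA.
Qed.

(** Turns a recurrence between counts into a quotient by 1 - q^k. *)
Lemma geom_unique k a b : (0 < k)%N ->
  (forall n, a n = b n + shift k a n) -> a =1 geom k b.
Proof.
move=> k0 aE n; elim/ltn_ind: n => n IH; rewrite aE geomE // /shift.
by case: leqP => // kn; rewrite IH // ltn_subrL k0 (leq_trans k0 kn).
Qed.

Lemma eq_geom k a b : a =1 b -> geom k a =1 geom k b.
Proof.
by move=> eab n; rewrite /geom; congr foldr; apply: eq_map => j; rewrite eab.
Qed.

(** Beyond the checked period, each coefficient adds a nonnegative term to the
    coefficient [k] places before it. *)
Lemma geom_eventually_ge0 {k a} M :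
  (0 < k)%N -> (forall n, (M + k <= n)%N -> 0 <= a n) ->
  all (fun n => 0 <= geom k a n) (iota M k) ->
  forall n, (M <= n)%N -> 0 <= geom k a n.
Proof.
move=> k0 a0 /allP win n; elim/ltn_ind: n => n IH Mn.
have [nMk|Mkn] := ltnP n (M + k); first by apply: win; rewrite mem_iota Mn.
rewrite geomE // /shift (leq_trans (leq_addl M k)) //.
by rewrite addr_ge0 ?a0 ?IH //; lia.
Qed.

(** * Counting partitions *)

Definition partitions (n : nat) : seq (seq nat) :=
  [seq p <- [seq [seq val i | i <- b] | b : n.-bseq 'I_n.+1] |
     is_partition p && (sumn p == n)].

Definition pcount (P : pred (seq nat)) : fps :=
  fun n => (count P (partitions n))%:Z.

Lemma partitions_uniq n : uniq (partitions n).
Proof.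
rewrite filter_uniq // map_inj_uniq ?enum_uniq //.
by move=> a b /(inj_map val_inj) /val_inj.
Qed.

Lemma mem_partitions p n :
  (p \in partitions n) = is_partition p && (sumn p == n).
Proof.
rewrite mem_filter; apply: andb_idr => /andP[pp /eqP sp].
have sz : (size [seq inord x : 'I_n.+1 | x <- p] <= n)%N.
  by rewrite size_map -sp partition_size.
apply/mapP; exists (Bseq sz); rewrite ?mem_enum //= -map_comp -[LHS]map_id.
apply/eq_in_map => x xp /=.
by rewrite inordK // ltnS -sp part_le_sumn.
Qed.

(** The empty partition, excluded from [mho], may be counted by [pcount]; excluding
    it through [P] makes the two series agree also at q^0. *)
Lemma mho_seriesE P : ~~ P [::] -> mho_series P =1 pcount P.
Proof.
move=> P0 n; rewrite (coef_mho_series (e := [seq p <- partitions n | P p])).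
- by rewrite size_filter.
- by rewrite filter_uniq ?partitions_uniq.
case=> [|x p]; rewrite mem_filter mem_partitions; first by rewrite (negPf P0) !andbF.
have -> : mho (x :: p) = is_partition (x :: p).
  by rewrite /mho /is_partition /=; case: x => [|x]; rewrite ?andbF ?andbT.
by rewrite [RHS]andbA andbC.
Qed.

Lemma eq_pcount P Q n :
  (forall p, is_partition p -> sumn p = n -> P p = Q p) ->
  pcount P n = pcount Q n.
Proof.
move=> ePQ; congr Posz; apply: eq_in_count => p.
by rewrite mem_partitions => /andP[pp /eqP]; apply: ePQ.
Qed.

Lemma pcount_nilp : pcount (@nilp nat) =1 qX 0.
Proof.
move=> n; congr Posz; rewrite (eq_count (a2 := pred1 [::])); last by case.
by rewrite count_uniq_mem ?partitions_uniq // mem_partitions eq_sym.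
Qed.

Lemma pcount_split Q P :
  pcount P =1 pcount (predI P Q) \+ pcount (predD P Q).
Proof.
move=> n; rewrite /pcount /= -PoszD; congr Posz.
rewrite -size_filter -(count_predC Q) !count_filter.
by congr addn; apply: eq_count => p /=; rewrite (andbC (P p)).
Qed.

Lemma geq_trans : transitive geq. Proof. by move=> y x z /[swap]; apply: leq_trans. Qed.
Lemma geq_anti : antisymmetric geq. Proof. by move=> x y; rewrite andbC => /anti_leq. Qed.
Lemma geq_total : total geq. Proof. by move=> x y; apply: leq_total. Qed.

(** Inserting a part [x] is a bijection from the partitions of n - x with parts
    in [Q] onto those of n having [x] as a part: a partition is determined by
    the multiset of its parts. *)
Lemma pcount_with_part x (Q : pred nat) : (0 < x)%N -> Q x ->
  pcount (fun p => (x \in p) && all Q p) =1 shift x (pcount (all Q)).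
Proof.
move=> x0 Qx n; rewrite /shift; case: leqP => [xn|nx]; last first.
  congr Posz; apply/eqP; rewrite -leqn0 leqNgt -has_count -all_predC.
  apply/allP => p; rewrite mem_partitions => /andP[_ /eqP sp] /=.
  by apply/negP => /andP[/part_le_sumn]; rewrite sp leqNgt nx.
pose ins p := sort geq (x :: p).
have ins_perm p : perm_eq (ins p) (x :: p) by rewrite perm_sort.
congr Posz; rewrite -!size_filter -[RHS](size_map ins).
apply: perm_size; apply: uniq_perm.
- by rewrite filter_uniq ?partitions_uniq.
- rewrite map_inj_in_uniq; first by rewrite filter_uniq ?partitions_uniq.
  move=> p r; rewrite mem_filter mem_partitions => /and3P[_ /andP[sp _] _].
  rewrite mem_filter mem_partitions => /and3P[_ /andP[sr _] _] epr.
  apply: (sorted_eq geq_trans geq_anti) => //.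
  by rewrite -(perm_cons x) -(permPl (ins_perm p)) epr ins_perm.
move=> p; rewrite mem_filter mem_partitions; apply/idP/mapP => [|[r]].
  case/andP=> /andP[xp Qp] /andP[/andP[sp pp] /eqP sn].
  have xr := perm_to_rem xp; exists (rem x p).
    rewrite mem_filter mem_partitions /is_partition.
    rewrite (perm_all _ xr) /= in Qp; rewrite (perm_all _ xr) /= in pp.
    case/andP: Qp => _ ->; case/andP: pp => _ ->.
    rewrite (subseq_sorted geq_trans (rem_subseq x p)) //=.
    by rewrite -sn (perm_sumn xr) /= addKn.
  apply: (sorted_eq geq_trans geq_anti) => //; first exact: sort_sorted geq_total _.
  by rewrite (perm_trans xr) // perm_sym ins_perm.
rewrite mem_filter mem_partitions => /and3P[Qr /andP[sr pr] /eqP sn] ->.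
rewrite (perm_mem (ins_perm r)) mem_head (perm_all _ (ins_perm r)) /= Qx Qr.
rewrite /is_partition (sort_sorted geq_total) (perm_all _ (ins_perm r)) /= x0 pr.
by rewrite (perm_sumn (ins_perm r)) /= sn subnKC.
Qed.

(** Allowing the part [x] divides the series by 1 - q^x. *)
Lemma pcount_remove_part x (Q : pred nat) : (0 < x)%N -> Q x ->
  pcount (all Q) =1
    pcount (all (predD1 Q x)) \+ shift x (pcount (all Q)).
Proof.
move=> x0 Qx n; rewrite (pcount_split (fun p => x \in p)) /= addrC.
congr (_ + _); last first.
  by rewrite -pcount_with_part //; apply: eq_pcount => p _ _ /=; rewrite andbC.
apply: eq_pcount => p _ _ /=; elim: p => //= y p <-.
by rewrite inE negb_or eq_sym; case: (y == x); case: (Q y); case: (x \in p).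
Qed.

Definition box (m h : nat) : pred nat := fun x => (m <= x <= h)%N.

Lemma box_remove_min {m h} : (0 < m <= h)%N ->
  pcount (all (box m h)) =1
    pcount (all (box m.+1 h)) \+ shift m (pcount (all (box m h))).
Proof.
case/andP=> m0 mh n; rewrite {1}(@pcount_remove_part m _) /box ?leqnn //=.
congr (_ + _); apply: eq_pcount => p _ _; apply: eq_all => x /=; lia.
Qed.

Lemma box_remove_max {m h} : (m <= h.+1)%N ->
  pcount (all (box m h.+1)) =1
    pcount (all (box m h)) \+ shift h.+1 (pcount (all (box m h.+1))).
Proof.
move=> mh n; rewrite {1}(@pcount_remove_part h.+1 _) /box ?leqnn ?andbT //=.
congr (_ + _); apply: eq_pcount => p _ _; apply: eq_all => x /=; lia.
Qed.

Lemma box_small m h n : (n < m)%N -> pcount (all (box m h)) n = qX 0 n.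
Proof.
move=> nm; rewrite -pcount_nilp; apply: eq_pcount => -[|x p] //= _ sp.
apply/negbTE; rewrite negb_and /box; apply/orP; left; lia.
Qed.

(** * Partitions with bounded spread *)

Lemma partition_bounds {p x} : is_partition p -> x \in p ->
  (smallest_part p <= x <= largest_part p)%N.
Proof.
case/andP=> sp _ xp; apply/andP; split.
  case/lastP: p sp xp => // p y; rewrite /smallest_part last_rcons.
  rewrite sorted_pairwise; last exact: geq_trans.
  rewrite pairwise_rcons mem_rcons inE => /andP[/allP yp _].
  by case/predU1P => [->|/yp].
case: p sp xp => //= y p /(order_path_min geq_trans) /allP yp.
by rewrite inE => /predU1P[->|/yp].
Qed.

Definition spread (L m : nat) : pred (seq nat) := fun p =>
  (m <= smallest_part p)%N && (largest_part p - smallest_part p <= L)%N.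

(** The two conditions say that [m] is a part and that all parts lie between [m]
    and m + L; removing that part [m] leaves an arbitrary partition of this
    box. *)
Lemma pcount_smallest L m : (0 < m)%N ->
  pcount (fun p => (smallest_part p == m) &&
                   (largest_part p - smallest_part p <= L)%N) =1
    shift m (pcount (all (box m (m + L)))).
Proof.
move=> m0 n; rewrite -pcount_with_part // ?/box ?leqnn ?leq_addr //.
apply: eq_pcount => p pp _; apply/andP/andP => [[/eqP sm lm]|[mp /allP bp]].
  have p0 : p != [::] by apply: contraTneq m0 => p0; rewrite -sm p0.
  split; first by rewrite -sm; case: (p) p0 => //= y r _; apply: mem_last.
  apply/allP => x /(partition_bounds pp); rewrite sm in lm *; lia.
have /andP[sm ml] := partition_bounds pp mp.
have sp : smallest_part p \in p by case: (p) mp => //= y r _; apply: mem_last.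
have lp : largest_part p \in p by case: (p) mp => //= y r _; apply: mem_head.
move: (bp _ sp) (bp _ lp); rewrite /=; lia.
Qed.

Lemma spread_split {L m} : (0 < m)%N ->
  pcount (spread L m) =1
    pcount (spread L m.+1) \+ shift m (pcount (all (box m (m + L)))).
Proof.
move=> m0 n; rewrite (pcount_split (fun p => smallest_part p == m)) /= addrC.
rewrite -pcount_smallest //.
congr (_ + _); apply: eq_pcount => p _ _; rewrite /= ?unfold_in /= /spread; lia.
Qed.

Lemma spread_small L m n : (n < m)%N -> pcount (spread L m) n = 0.
Proof.
move=> nm; congr Posz; apply/eqP; rewrite -leqn0 leqNgt -has_count -all_predC.
apply/allP => p; rewrite mem_partitions => /andP[_ /eqP sp] /=.
rewrite /spread negb_and -ltnNge; apply/orP; left.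
case: p sp => [_|x p sp]; first exact: leq_ltn_trans nm.
by apply: leq_ltn_trans nm; rewrite -sp; apply/part_le_sumn/mem_last.
Qed.

(** This is (1 - q^L) T_m = 1/(m,...,m+L-1) - 1, where L = l + 1 and T_m is the
    series of the partitions with smallest part at least [m] and spread at most
    L. By downward induction on [m]: in degrees below [m] both sides vanish, and
    T_m - T_(m+1) = q^m/(m,...,m+L) is, up to the factor 1 - q^L, the difference
    of 1/(m,...,m+L-1) and 1/(m+1,...,m+L), which are obtained by forbidding the
    largest or the smallest part in the box from [m] to m + L. *)
Lemma spread_telescope l m n : (0 < m)%N ->
  pcount (spread l.+1 m) n + qX 0 n =
    shift l.+1 (pcount (spread l.+1 m)) n + pcount (all (box m (m + l))) n.
Proof.
move=> m0; have [k nk] := ubnP (n.+1 - m); elim: k => // k IH in m m0 nk *.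
have [nm|mn] := ltnP n m.
  rewrite spread_small // box_small // /shift; case: leqP => // _.
  by rewrite spread_small //; lia.
have {IH} := IH m.+1 isT ltac:(lia); rewrite addSnnS => IH.
rewrite spread_split // (eq_shift _ (spread_split m0)) shiftD /= shift_shift.
have := @box_remove_min m (m + l.+1) ltac:(lia) n.
have := @box_remove_max m (m + l) ltac:(lia) n.
rewrite /= -addnS [(l.+1 + m)%N]addnC => bmax bmin.
by rewrite addrAC IH -addrA -bmin bmax addrA addrAC.
Qed.

(** * The series of the theorem *)

(** Multiplication by q^2 + q^4 - 1. *)
Definition numer (a : fps) : fps := shift 2 a \+ shift 4 a \- a.

Lemma numer_geom k a : (0 < k)%N -> numer (geom k a) =1 geom k (numer a).
Proof.
move=> k0; apply: geom_unique => // n; rewrite /numer shiftB /= shiftD /=.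
rewrite !shift_shift !(addnC k) -!shift_shift.
have gE : geom k a =1 a \+ shift k (geom k a) by move=> i; rewrite geomE.
rewrite [in LHS](eq_shift 2 gE) [in LHS](eq_shift 4 gE) (shiftD 2) (shiftD 4) /= geomE //.
ring.
Qed.

(** The series (1-q^4) G - 1, where G = G_{4,2}; its coefficient at q^n is, for
    n > 0, the step from the coefficient of G at q^(n-4) to that at q^n. The division by
    1 - q^4 comes first because it leaves a single negative coefficient:
    (q^2+q^4-1)/(1-q^4) = q^2/(1-q^4) - 1. *)
Definition G2_step : fps := geom 6 (geom 5 (geom 3 (geom 4 (numer (qX 0))))).

Lemma G2_step_box : numer (pcount (all (box 3 6))) =1 G2_step.
Proof.
have b44 : pcount (all (box 4 4)) =1 geom 4 (qX 0).
  apply: geom_unique => // n; rewrite (@box_remove_min 4 4) //=; congr (_ + _).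
  rewrite -pcount_nilp; apply: eq_pcount => -[|x p] //= _ _.
  by apply/negbTE; rewrite negb_and /box; apply/orP; left; lia.
have b34 : pcount (all (box 3 4)) =1 geom 3 (geom 4 (qX 0)).
  by apply: geom_unique => // n; rewrite (@box_remove_min 3 4) //= b44.
have b35 : pcount (all (box 3 5)) =1 geom 5 (geom 3 (geom 4 (qX 0))).
  by apply: geom_unique => // n; rewrite (@box_remove_max 3 4) //= b34.
have b36 : pcount (all (box 3 6)) =1 geom 6 (geom 5 (geom 3 (geom 4 (qX 0)))).
  by apply: geom_unique => // n; rewrite (@box_remove_max 3 5) //= b35.
move=> n; rewrite /numer /= (eq_shift 2 b36) (eq_shift 4 b36) b36.
rewrite -[LHS]/(numer _ n) numer_geom //; apply: eq_geom => {}n.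
rewrite numer_geom //; apply: eq_geom => {}n.
by rewrite numer_geom //; apply: eq_geom => {}n; rewrite numer_geom.
Qed.

Lemma G2_geom : G2 4 =1 geom 4 (qX 0 \+ G2_step).
Proof.
have G2E : G2 4 =1 shift 2 (pcount (all (box 2 6))) \- pcount (spread 4 3).
  by move=> n; rewrite /G2 /= !mho_seriesE // (pcount_smallest 4).
apply: geom_unique => // n; rewrite (eq_shift 4 G2E) G2E shiftB /=.
have b26 := @box_remove_min 2 6 isT; rewrite -G2_step_box /numer /=.
have := @spread_telescope 3 3 n isT => /= tel.
rewrite shift_shift (eq_shift 2 b26) shiftD /= shift_shift.
rewrite (eq_shift 4 b26) shiftD /= shift_shift.
by rewrite -[pcount (spread 4 3) n](addrK (qX 0 n)) tel; ring.
Qed.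

(** The only negative coefficients of the successive quotients are at q^0; then
    at q^0 and q^3; at q^0 and q^3 again; and at q^0, q^3, q^6 and q^9. *)
Lemma G2_step_ge0 n : (10 <= n)%N -> 0 <= G2_step n.
Proof.
have n0 i : (1 <= i)%N -> 0 <= numer (qX 0) i.
  by case: i => [|[|[|[|[|i]]]]].
have n4 i : (1 <= i)%N -> 0 <= geom 4 (numer (qX 0)) i.
  apply: geom_eventually_ge0 => // {}i ?; apply: n0; lia.
have n34 i : (4 <= i)%N -> 0 <= geom 3 (geom 4 (numer (qX 0))) i.
  apply: geom_eventually_ge0 => // {}i ?; apply: n4; lia.
have n345 i : (4 <= i)%N -> 0 <= geom 5 (geom 3 (geom 4 (numer (qX 0)))) i.
  apply: geom_eventually_ge0 => // {}i ?; apply: n34; lia.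
apply: geom_eventually_ge0 => // {}i ?; apply: n345; lia.
Qed.

Theorem theorem21 : forall n : nat, 0 <= (G2 4 \+ qX 3 \+ qX 9) n.
Proof.
move=> n; rewrite /= G2_geom.
have [n10|] := ltnP n 10.
  have /allP : all (fun i => 0 <= geom 4 (qX 0 \+ G2_step) i + qX 3 i + qX 9 i) (iota 0 10).
    by vm_compute.
  by apply; rewrite mem_iota.
have F_ge0 : forall i, (10 <= i)%N -> 0 <= geom 4 (qX 0 \+ G2_step) i.
  apply: geom_eventually_ge0 => // i i10; rewrite addr_ge0 ?G2_step_ge0 //; lia.
by move=> n10; rewrite addr_ge0 // addr_ge0 // F_ge0.
Qed.
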